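(* Let $G$ be a completely metrizable topological group with identity $e$, let $d$ be a left-invariant compatible metric on $G$, and let $T\colon G\to G$ be a continuous endomorphism of $G$. Then the following assertions are equivalent: (1) $T$ admits a dense set of semi-irregular points; (2) $T$ admits a residual set of semi-irregular points; (3) there exists $\delta>0$ such that for every sequence $(O_j)_{j\in\mathbb{N}}$ of nonempty open subsets of $G$, there exists a sequence $(K_j)_{j\in\mathbb{N}}$ of Cantor sets with $K_j\subset O_j$ such that $\bigcup_{j=1}^\infty K_j$ is Li-Yorke $\delta$-scrambled; (4) the proximal relation of $T$ is dense in $G\times G$ and $T$ is sensitive; (5) the proximal cell of $e$ is dense in $G$ and there exists $x\in G$ such that $\limsup_{n\to\infty} d(T^nx,e)>0$.
   Context: A topological group is completely metrizable if its topology is induced by some complete metric. A compatible metric $d$ on $G$ is a metric inducing the topology of $G$ (not required to be complete); it is left-invariant if $d(zx,zy)=d(x,y)$ for all $x,y,z\in G$. A continuous endomorphism is a continuous group homomorphism $G\to G$. $\mathbb{N}$ is the set of positive integers. A set is residual if it contains a dense $G_\delta$ subset. A Cantor set is a subset homeomorphic to the Cantor ternary set. A point $x\in G$ is semi-irregular for $T$ if $\liminf_{n\to\infty} d(T^nx,e)=0$ and $\limsup_{n\to\infty} d(T^nx,e)>0$. A pair $(x,y)\in G\times G$ is proximal if $\liminf_{n\to\infty}d(T^nx,T^ny)=0$; the proximal relation is the set of all proximal pairs; the proximal cell of $x$ is $\{y\in G:(x,y)\text{ is proximal}\}$. For $\delta>0$, a pair $(x,y)$ is Li-Yorke $\delta$-chaotic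 if $\liminf_{n\to\infty}d(T^nx,T^ny)=0$ and $\limsup_{n\to\infty}d(T^nx,T^ny)\ge\delta$. A set $K\subset G$ is Li-Yorke $\delta$-scrambled if any two distinct points of $K$ form a Li-Yorke $\delta$-chaotic pair. $T$ is sensitive if there exists $\delta>0$ such that for every $x\in G$ and $\varepsilon>0$ there exist $y\in G$ with $d(x,y)<\varepsilon$ and $n\in\mathbb{N}$ such that $d(T^nx,T^ny)>\delta$. *)

(* Defs.v *)
From HB Require Import structures.
From mathcomp Require Import all_boot all_order all_algebra.
From mathcomp Require Import all_classical all_reals all_analysis.
From mathcomp Require Import borel_hierarchy.

Set Implicit Arguments.
Unset Strict Implicit.
Unset Printing Implicit Defensive.

Import Order.TTheory GRing.Theory Num.Theory.
Import numFieldNormedType.Exports.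

Local Open Scope classical_set_scope.
Local Open Scope ring_scope.

(* Not necessarily abelian topological groups, written multiplicatively in
   the scope %g; the library only has the additive abelian
   topologicalZmodType. *)
HB.mixin Record isTopologicalGroup G & Topological G & Group G := {
  mulg_continuous : continuous (fun x : G * G => (x.1 * x.2)%g) ;
  invg_continuous : continuous (fun x : G => (x^-1)%g)
}.

#[short(type="topologicalGroupType")]
HB.structure Definition TopologicalGroup :=
  {G of Topological G & Group G & isTopologicalGroup G}.

Section Metrics.
Context {R : realType}.

(* Metrics are plain functions rather than metricType instances, because two
   unrelated metrics have to coexist on one group: the left-invariant one and
   the complete one. *)
Definition is_metric (X : Type) (d : X -> X -> R) :=
  [/\ forall x y, 0 <= d x y,
      forall x y, d x y = 0 <-> x = y,
      forall x y, d x y = d y x &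
      forall x y z, d x z <= d x y + d y z].

Definition compatible_metric (X : topologicalType) (d : X -> X -> R) :=
  is_metric d /\
  forall (x : X) (A : set X),
    nbhs x A <-> exists2 e : R, 0 < e & [set y | d x y < e] `<=` A.

Definition complete_metric (X : Type) (d : X -> X -> R) :=
  forall u : nat -> X,
    (forall e : R, 0 < e ->
      exists N, forall m n, (N <= m)%N -> (N <= n)%N -> d (u m) (u n) < e) ->
    exists l : X, forall e : R, 0 < e ->
      exists N, forall n, (N <= n)%N -> d (u n) l < e.

Definition left_invariant (G : groupType) (d : G -> G -> R) :=
  forall x y z : G, d (z * x)%g (z * y)%g = d x y.

End Metrics.

Definition completely_metrizable (R : realType) (X : topologicalType) :=
  exists2 rho : X -> X -> R, compatible_metric rho & complete_metric rho.

Definition residual (X : topologicalType) (S : set X) :=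
  exists D : set X, [/\ Gdelta D, dense D & D `<=` S].

(* Homeomorphism between subsets for their subspace topologies. The maps are
   total functions of which only the restrictions to A and B matter; this is
   no restriction for X and Y inhabited. *)
Definition homeomorphic_sets (X Y : topologicalType) (A : set X) (B : set Y) :=
  exists (f : X -> Y) (g : Y -> X),
    [/\ {within A, continuous f}, {within B, continuous g},
        forall x, A x -> B (f x) /\ g (f x) = x &
        forall y, B y -> A (g y) /\ f (g y) = y].

(* The reals with a ternary expansion 0.a_0 a_1 a_2 ... all of whose digits
   are 0 or 2. *)
Definition cantor_ternary_set (R : realType) : set R :=
  [set x | exists a : nat -> bool,
     series (fun k => (2 * a k)%:R / 3 ^+ k.+1 : R) @ \oo --> x].

Definition is_cantor_set (R : realType) (X : topologicalType) (K : set X) :=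
  homeomorphic_sets (@cantor_ternary_set R) K.

Section Dynamics.
Context {R : realType} {X : Type}.
Variables (d : X -> X -> R) (T : X -> X).

(* Taken in the extended reals: d may be unbounded along orbits. *)
Definition liminf_dist (x y : X) : \bar R :=
  limn_einf (fun n => (d (iter n T x) (iter n T y))%:E).

Definition limsup_dist (x y : X) : \bar R :=
  limn_esup (fun n => (d (iter n T x) (iter n T y))%:E).

Definition proximal_relation : set (X * X) :=
  [set p | liminf_dist p.1 p.2 = 0%E].

Definition proximal_cell (x : X) : set X :=
  [set y | proximal_relation (x, y)].

Definition li_yorke_pair (delta : R) (x y : X) :=
  liminf_dist x y = 0%E /\ (delta%:E <= limsup_dist x y)%E.

Definition li_yorke_scrambled (delta : R) (K : set X) :=
  forall x y, K x -> K y -> x <> y -> li_yorke_pair delta x y.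

Definition sensitive :=
  exists2 delta : R, 0 < delta &
    forall (x : X) (e : R), 0 < e ->
      exists y : X, d x y < e /\
        exists2 n : nat, (0 < n)%N & delta < d (iter n T x) (iter n T y).

End Dynamics.

Section SemiIrregular.
Context {R : realType} {G : groupType}.
Variables (d : G -> G -> R) (T : G -> G).

Definition semi_irregular (x : G) :=
  limn_einf (fun n => (d (iter n T x) 1%g)%:E) = 0%E /\
  (0 < limn_esup (fun n => (d (iter n T x) 1%g)%:E))%E.

End SemiIrregular.

(* Main.v *)
Require Import Defs.
From HB Require Import structures.
From mathcomp Require Import all_boot all_order all_algebra.
From mathcomp Require Import all_classical all_reals all_analysis.
From mathcomp Require Import borel_hierarchy.
From mathcomp Require Import lra.

Set Implicit Arguments.
Unset Strict Implicit.
Unset Printing Implicit Defensive.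

Import Order.TTheory GRing.Theory Num.Theory.
Import numFieldNormedType.Exports.

Local Open Scope classical_set_scope.
Local Open Scope ring_scope.

(** The proof rests on one remark: by left invariance and multiplicativity,
    d (T^n x) (T^n y) = d (T^n (y^-1 x)) e, so every property of a pair (x, y)
    is a property of the single orbit of y^-1 x compared with the fixed
    point e ([dist_iter]).

    Suppose that the proximal cell of e is dense and that some orbit does not
    converge to e, which is assertion (5). Then T is sensitive at e
    ([sensitive_at1_of_proximal]): if all orbits starting near e stayed
    close to e, then an orbit starting in the cell would be trapped near e as
    soon as it came close to e, and density of the cell together with left
    invariance would trap every orbit. Sensitivity at e moves to every point by
    translation, hence for some delta > 0 and all n the points whose orbit,
    after time n, comes within 1/(n+1) of e and also goes further than delta
    from e form a dense open set V_n ([generic_sets]). No V_n contains e, and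
    a point in all but finitely many V_n is semi-irregular with upper limit at
    least delta.

    The Baire category theorem for a complete metric ([baire_metric]) then
    gives (2). The sets {(x, y) | y^-1 x in V_n} are open and dense in G x G
    and avoid the diagonal, so a Mycielski construction ([mycielski]) yields
    Cantor sets inside prescribed open sets, any two points of whose union lie
    in almost all of them; this is (3). The remaining implications are short:
    (3) gives proximal pairs in every open box and two points of every ball
    whose orbits separate, (4) is transported to the orbits compared with e by
    (x, y) |-> y^-1 x and gives an orbit far from e by Baire again. Finally (1)
    contains (5), so both (1) and (2) give everything that follows from (5).

    Two metrics coexist: the left-invariant d controls the dynamics, while
    convergence of nested balls uses the complete metric rho. *)

(** * Upper and lower limits of real sequences *)

Section LimInfSup.
Context {R : realType}.
Implicit Types (u : nat -> R) (c : R).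

Lemma limn_esup_gt u c : (c%:E < limn_esup (fun n => (u n)%:E))%E ->
  forall N, exists2 n, (N <= n)%N & c < u n.
Proof.
move=> cu N; apply: contrapT => nex.
move: cu; apply/negP; rewrite -leNgt.
apply: ge_ereal_inf; exists (ereal_sup [set (u x)%:E | x in [set n | (N <= n)%N]]).
  by exists [set n | (N <= n)%N] => //; exists N.
apply: ge_ereal_sup => _ [n Nn <-]; rewrite lee_fin leNgt; apply/negP => cn.
by apply: nex; exists n.
Qed.

Lemma le_limn_esup u c : (forall N, exists2 n, (N <= n)%N & c < u n) ->
  (c%:E <= limn_esup (fun n => (u n)%:E))%E.
Proof.
move=> cu; apply: le_ereal_inf_tmp => _ [V [N _ NV] <-].
have [n Nn cn] := cu N.
apply: le_ereal_sup_tmp; exists (u n)%:E; last by rewrite lee_fin ltW.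
by exists n => //; exact: NV.
Qed.

Lemma limn_einf_eq0P u : (forall n, 0 <= u n) ->
  limn_einf (fun n => (u n)%:E) = 0%E <->
  forall e : R, 0 < e -> forall N, exists2 n, (N <= n)%N & u n < e.
Proof.
move=> u0; rewrite /limn_einf.
have -> : (\- (fun n => (u n)%:E))%E = (fun n => (- u n)%:E) by apply/funext.
split=> [u_0 e e0 N|ue].
  have [|n Nn nu] := @limn_esup_gt (fun n => - u n) (- e) _ N.
    by rewrite -(oppeK (limn_esup _)) u_0 oppe0 lte_fin oppr_lt0.
  by exists n => //; rewrite -ltrN2.
suff -> : limn_esup (fun n => (- u n)%:E) = 0%E by rewrite oppe0.
apply/eqP; rewrite eq_le; apply/andP; split.
  apply: ge_ereal_inf; exists (ereal_sup [set (- u x)%:E | x in [set: nat]]).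
    by exists setT => //; exact: filterT.
  by apply: ge_ereal_sup => _ [n _ <-]; rewrite lee_fin oppr_le0.
apply/lee_addgt0Pr => e e0; rewrite -leeBlDr// sub0e -EFinN.
apply: le_limn_esup => N; have [n Nn ne] := ue e e0 N.
by exists n => //; rewrite ltrN2.
Qed.

Lemma limn_esup_gt0P u :
  (0 < limn_esup (fun n => (u n)%:E))%E <->
  exists2 c : R, 0 < c & forall N, exists2 n, (N <= n)%N & c < u n.
Proof.
split=> [u0|[c c0 /le_limn_esup]]; last by apply: lt_le_trans; rewrite lte_fin.
have [c /andP[c0 cu]] : exists c : R, (0 < c%:E < limn_esup (fun n => (u n)%:E))%E.
  case: (limn_esup _) u0 => [r| |//]; last by exists 1; rewrite lte_fin ltr01 ltry.
  by rewrite lte_fin => r0; exists (r / 2); rewrite !lte_fin; lra.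
by exists c; [rewrite -lte_fin|exact: limn_esup_gt].
Qed.

End LimInfSup.

(** * Codings of Cantor sets by binary sequences *)

Section TernaryCoding.

Definition agree (N : nat) (a b : nat -> bool) :=
  forall k, (k < N)%N -> a k = b k.

(** The two clauses are continuity of f, and of its inverse on the range, for
    the product topology on binary sequences; neighborhoods in that topology
    are given by agreement on an initial segment. *)
Definition cantor_embedding (X : topologicalType) (f : (nat -> bool) -> X) :=
  (forall a V, nbhs (f a) V -> exists N, forall b, agree N a b -> V (f b)) /\
  (forall a N, exists2 V, nbhs (f a) V & forall b, V (f b) -> agree N a b).

Lemma cantor_embedding_inj (X : topologicalType) (f : (nat -> bool) -> X) :
  cantor_embedding f -> injective f.
Proof.
move=> [_ sep] a b fab; apply/funext => k.
have [V Va Vagree] := sep a k.+1.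
by apply: (Vagree b) => //; rewrite -fab; exact: nbhs_singleton.
Qed.

(** Both ranges are homeomorphic to the space of binary sequences, so the
    homeomorphism is decoding followed by coding. *)
Lemma homeomorphic_cantor_embeddings (X Y : topologicalType)
    (f : (nat -> bool) -> X) (g : (nat -> bool) -> Y) :
  cantor_embedding f -> cantor_embedding g ->
  homeomorphic_sets (range f) (range g).
Proof.
have inv (Z : topologicalType) (h : (nat -> bool) -> Z) : cantor_embedding h ->
    exists k : Z -> nat -> bool, forall a, k (h a) = a.
  move=> hemb.
  exists (fun z => if pselect (exists a, h a = z) is left ez
                   then sval (cid ez) else fun=> false) => a.
  case: pselect => [ez|[]]; last by exists a.
  by apply: (cantor_embedding_inj hemb); case: cid.
have cont (Z Z' : topologicalType) (h : (nat -> bool) -> Z)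
    (h' : (nat -> bool) -> Z') (k : Z -> nat -> bool) :
    cantor_embedding h -> cantor_embedding h' -> (forall a, k (h a) = a) ->
    {within range h, continuous (h' \o k)}.
  move=> [_ sep] [h'c _] hk; apply/subspace_continuousP => _ [a _ <-] V nV.
  have {nV} /h'c[N NV] : nbhs (h' a) V by rewrite -(hk a).
  have [U Ua UN] := sep a N.
  apply: filterS Ua => z Uz [b _ zb]; move: Uz; rewrite -zb => /UN/NV.
  by rewrite -{1}(hk b).
move=> femb gemb.
have [f' f'K] := inv _ _ femb; have [g' g'K] := inv _ _ gemb.
exists (g \o f'), (f \o g'); split.
- exact: cont.
- exact: cont.
- by move=> _ [a _ <-] /=; rewrite f'K g'K; split => //; exists a.
- by move=> _ [a _ <-] /=; rewrite g'K f'K; split => //; exists a.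
Qed.

Context {R : realType}.

Definition ternary_term (a : nat -> bool) (k : nat) : R :=
  (2 * a k)%:R / 3 ^+ k.+1.

Definition ternary (a : nat -> bool) : R := limn (series (ternary_term a)).

Lemma ternary_term_ge0 a k : 0 <= ternary_term a k.
Proof. by rewrite divr_ge0 ?exprn_ge0. Qed.

(** The bound telescopes, so the tail of the expansion from rank m on is at
    most 3^-m. *)
Lemma ternary_term_le a k : ternary_term a k <= 3 ^- k - 3 ^- k.+1.
Proof.
rewrite /ternary_term exprS invfM; set t := 3 ^- k.
have : 0 <= t by rewrite invr_ge0 exprn_ge0.
by case: (a k); rewrite ?muln0 ?muln1; lra.
Qed.

Lemma ternary_series_le a m n : (m <= n)%N ->
  series (ternary_term a) n <= series (ternary_term a) m + 3 ^- m.
Proof.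
move=> mn; suff : series (ternary_term a) n + 3 ^- n <=
    series (ternary_term a) m + 3 ^- m.
  by apply: le_trans; rewrite lerDl invr_ge0 exprn_ge0.
elim: n mn => [|n IH]; first by rewrite leqn0 => /eqP ->.
rewrite leq_eqVlt => /predU1P[-> //|/IH]; apply: le_trans.
by rewrite seriesSr /=; have := ternary_term_le a n; lra.
Qed.

Lemma ternary_is_cvg a : cvgn (series (ternary_term a)).
Proof.
apply: nondecreasing_is_cvgn.
  by apply/nondecreasing_seqP => n; rewrite seriesSr lerDl ternary_term_ge0.
by exists (series (ternary_term a) 0 + 3 ^- 0) => _ [n _ <-]; exact: ternary_series_le.
Qed.

Lemma ternary_ge a n : series (ternary_term a) n <= ternary a.
Proof.
apply: (@nondecreasing_cvgn_le R (series (ternary_term a))); last exact: ternary_is_cvg.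
by apply/nondecreasing_seqP => k; rewrite seriesSr lerDl ternary_term_ge0.
Qed.

Lemma ternary_le a n : ternary a <= series (ternary_term a) n + 3 ^- n.
Proof.
apply: limr_le; first exact: ternary_is_cvg.
by exists n => // m; exact: ternary_series_le.
Qed.

Lemma series_ternary_agree a b n : agree n a b ->
  series (ternary_term a) n = series (ternary_term b) n.
Proof.
move=> ab; rewrite /series /= !big_mkord; apply: eq_bigr => i _.
by rewrite /ternary_term ab.
Qed.

Lemma ternary_agree a b n : agree n a b -> `|ternary a - ternary b| <= 3 ^- n.
Proof.
move=> /series_ternary_agree ab.
have := ternary_ge a n; have := ternary_ge b n.
have := ternary_le a n; have := ternary_le b n.
by rewrite ab ler_norml; lra.
Qed.

(** At the first differing digit the gap is 2/3^(n+1), and the later digits can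
    close at most half of it. *)
Lemma ternary_separate a b n : agree n a b -> a n -> ~~ b n ->
  3 ^- n.+1 <= ternary a - ternary b.
Proof.
move=> /series_ternary_agree ab an /negbTE bn.
have := ternary_ge a n.+1; have := ternary_le b n.+1.
rewrite !seriesSr /= ab /ternary_term an bn muln1 muln0 mul0r addr0.
by lra.
Qed.

Lemma ternary_close a b n : `|ternary a - ternary b| < 3 ^- n -> agree n a b.
Proof.
elim: n => [_ k //|n IH] abn.
have abn' : agree n a b.
  apply: IH; apply: lt_le_trans abn _.
  by rewrite lef_pV2 ?posrE ?exprn_gt0// ler_weXn2l// ler1n.
move=> k; rewrite ltnS leq_eqVlt => /predU1P[->|]; last exact: abn'.
move: abn; rewrite ltr_norml.
case an: (a n); case bn: (b n) => //.
  by have := ternary_separate abn' an (negbT bn); lra.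
have ban' : agree n b a by move=> i /abn'.
by have := ternary_separate ban' bn (negbT an); lra.
Qed.

Lemma range_ternary : range ternary = @cantor_ternary_set R.
Proof.
apply/seteqP; split=> [_ [a _ <-]|x [a ax]].
  by exists a; exact: ternary_is_cvg.
by exists a => //; apply/cvg_lim.
Qed.

Lemma ternary_embedding : cantor_embedding ternary.
Proof.
split=> [a V /nbhs_ballP[e /= e0 eV]|a N].
  have [N Ne] : exists N, 3 ^- N < e.
    have := @cvg_geometric R 1 3^-1.
    rewrite ger0_norm ?invf_lt1 ?ltr1n// => /(_ isT)/cvgr0Pnorm_lt/(_ _ e0)[N _].
    move=> /(_ N (leqnn _)); rewrite /= mul1r exprVn => Ne.
    by exists N; apply: le_lt_trans Ne; exact: ler_norm.
  by exists N => b /ternary_agree ab; apply: eV; exact: le_lt_trans ab _.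
exists (ball (ternary a) (3 ^- N)).
  by apply: nbhsx_ballx; rewrite invr_gt0 exprn_gt0.
by move=> b; exact: ternary_close.
Qed.

Lemma cantor_embedding_range (X : topologicalType) (f : (nat -> bool) -> X) :
  cantor_embedding f -> is_cantor_set R (range f).
Proof.
move=> femb; rewrite /is_cantor_set -range_ternary.
exact: homeomorphic_cantor_embeddings ternary_embedding femb.
Qed.

End TernaryCoding.
Lemma openX (X Y : topologicalType) (A : set X) (B : set Y) :
  open A -> open B -> open (A `*` B).
Proof.
rewrite !openE => Ao Bo [x y] [/= /Ao nA /Bo nB].
by exists (A, B).
Qed.

(** * Compatible metrics and the Baire property *)

Section CompatibleMetric.
Context {R : realType} {X : topologicalType} (rho : X -> X -> R).
Hypothesis rho_compat : compatible_metric rho.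

Let rho_metric : is_metric rho. Proof. by case: rho_compat. Qed.

Lemma dist_xx x : rho x x = 0.
Proof. by case: rho_metric => _ eq0 _ _; apply/eq0. Qed.

Lemma dist_sym x y : rho x y = rho y x.
Proof. by case: rho_metric. Qed.

Lemma dist_triangle y x z : rho x z <= rho x y + rho y z.
Proof. by case: rho_metric. Qed.

Lemma dist_ge0 x y : 0 <= rho x y.
Proof. by case: rho_metric. Qed.

Lemma nbhs_metricP x A :
  nbhs x A <-> exists2 e : R, 0 < e & [set y | rho x y < e] `<=` A.
Proof. by case: rho_compat. Qed.

(** Balls are handled as pairs (center, radius), so that nested sequences and
    families of balls can be produced by choice functions. *)
Definition metric_ball (p : X * R) := [set y | rho p.1 y < p.2].
Definition metric_cball (p : X * R) := [set y | rho p.1 y <= p.2].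

Lemma open_metric_ball p : open (metric_ball p).
Proof.
rewrite openE => y py; apply/nbhs_metricP; exists (p.2 - rho p.1 y).
  by rewrite subr_gt0.
move=> z /= yz; rewrite /metric_ball /=.
by have := dist_triangle y p.1 z; lra.
Qed.

Lemma metric_ball_center x r : 0 < r -> metric_ball (x, r) x.
Proof. by rewrite /metric_ball /= dist_xx. Qed.

Lemma subset_ball_cball p : metric_ball p `<=` metric_cball p.
Proof. by move=> x /ltW. Qed.

Lemma open_metricP (U : set X) x : open U -> U x ->
  exists2 e : R, 0 < e & [set y | rho x y < e] `<=` U.
Proof. by move=> Uo Ux; apply/nbhs_metricP; exact: open_nbhs_nbhs. Qed.

(** The shrinking step of both category arguments: a closed ball of small radius
    inside a given open set. *)
Lemma cball_in_open (U : set X) (e : R) : open U -> U !=set0 -> 0 < e ->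
  exists p : X * R, 0 < p.2 <= e /\ metric_cball p `<=` U.
Proof.
move=> Uo [x Ux] e0; have [r r0 rU] := open_metricP Uo Ux.
exists (x, Num.min e (r / 2)); split=> /=.
  by rewrite lt_min e0 divr_gt0//= ge_min lexx.
by move=> y; rewrite /metric_cball /= le_min => /andP[_ xy]; apply: rU => /=; lra.
Qed.

Hypothesis rho_complete : complete_metric rho.

(** The limit of the centers lies in every closed ball, hence in every open
    ball, since each closed ball sits in the preceding open one. *)
Lemma nested_balls (p : nat -> X * R) :
  (forall n, 0 < (p n).2 <= n.+1%:R^-1) ->
  (forall n, metric_cball (p n.+1) `<=` metric_ball (p n)) ->
  exists l, forall n, metric_ball (p n) l.
Proof.
move=> pr pS.
have mono n m : (n <= m)%N -> metric_ball (p m) `<=` metric_ball (p n).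
  elim: m => [|m IH]; first by rewrite leqn0 => /eqP ->.
  rewrite leq_eqVlt => /predU1P[-> //|/IH]; apply: subset_trans.
  exact: subset_trans (@subset_ball_cball _) (pS m).
have ctr n m : (n <= m)%N -> rho (p n).1 (p m).1 < (p n).2.
  move=> /mono; apply; rewrite /metric_ball /= dist_xx.
  by case/andP: (pr m).
have [|l lP] := rho_complete (u := fun n => (p n).1).
  move=> e e0; have e20 : 0 < e / 2 by rewrite divr_gt0.
  have [N _ /(_ N (leqnn _))] := near_infty_natSinv_lt (PosNum e20).
  rewrite /= => Ne; exists N => m k /ctr Nm /ctr Nk.
  have := dist_triangle (p N).1 (p m).1 (p k).1.
  rewrite (dist_sym (p m).1 (p N).1); case/andP: (pr N) => _ /le_lt_trans/(_ Ne); lra.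
exists l => n; apply: pS; rewrite /metric_cball /=.
apply/ler_addgt0Pr => e e0; have [N NP] := lP e e0.
have /ctr nm : (n.+1 <= maxn n.+1 N)%N by exact: leq_maxl.
have /NP lm : (N <= maxn n.+1 N)%N by exact: leq_maxr.
by have := dist_triangle (p (maxn n.+1 N)).1 (p n.+1).1 l; lra.
Qed.

(** The next ball of a nested sequence can always be taken inside the next dense
    open set. *)
Lemma baire_metric (V : nat -> set X) :
  (forall n, open (V n) /\ dense (V n)) -> dense (\bigcap_n V n).
Proof.
move=> Vod O O0 Oo.
have [|next nextP] := @choice (nat * (X * R)) (X * R) (fun i q => 0 < i.2.2 ->
    0 < q.2 <= i.1.+2%:R^-1 /\ metric_cball q `<=` metric_ball i.2 `&` V i.1).
  move=> [n [x r]] /=.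
  have [r0|] := boolP (0 < r); last by exists (x, r).
  have [Vo Vd] := Vod n.
  have UV : metric_ball (x, r) `&` V n !=set0.
    apply: Vd; last exact: open_metric_ball.
    by exists x; exact: metric_ball_center.
  have [|q qP] := cball_in_open (openI (@open_metric_ball (x, r)) Vo) UV
    (e := n.+2%:R^-1); first by rewrite invr_gt0.
  by exists q.
have [p0 [p0r p0O]] := cball_in_open Oo O0 (@ltr01 R).
pose p := fix p n := if n is m.+1 then next (m, p m) else p0.
have pr n : 0 < (p n).2 <= n.+1%:R^-1.
  elim: n => [|n /andP[IH _]]; first by rewrite invr1.
  by have [] := nextP (n, p n) IH.
have pS n : metric_cball (p n.+1) `<=` metric_ball (p n) `&` V n.
  by have /andP[+ _] := pr n => /(nextP (n, p n))[].
have [|l lP] := nested_balls pr; first by move=> n y /pS[].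
exists l; split; first by apply/p0O/subset_ball_cball/(lP 0).
by move=> n _; have /subset_ball_cball/pS[] := lP n.+1.
Qed.

(** * The Mycielski construction *)

(** A product of two open sets meets the dense open set W, so it can be shrunk
    into W; finitely many pairs are treated one after the other, and shrinking
    further does not spoil the pairs already treated. *)
Lemma shrink_pairs (I : eqType) (W : set (X * X)) (U : I -> set X)
    (s : seq (I * I)) :
  open W -> dense W -> (forall i, open (U i) /\ U i !=set0) ->
  exists V : I -> set X,
    (forall i, [/\ open (V i), V i !=set0 & V i `<=` U i]) /\
    forall i k, (i, k) \in s -> i != k -> V i `*` V k `<=` W.
Proof.
move=> Wo Wd; elim: s U => [|[i k] s IH] U Uo.
  by exists U; split=> // i; have [? ?] := Uo i; split.
have {IH} [V [VU VW]] := IH U Uo.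
have [<-|ik] := eqVneq i k.
  (* diagonal pairs are not constrained *)
  exists V; split=> // a b; rewrite inE => /predU1P[[-> ->]|]; last exact: VW.
  by rewrite eqxx.
have [Vio [x Vix] _] := VU i; have [Vko [y Vky] _] := VU k.
have [|[x' y'] [[/= Vix' Vky'] Wxy]] := Wd (V i `*` V k) _ (openX Vio Vko).
  by exists (x, y).
have : nbhs (x', y') W by exact: open_nbhs_nbhs.
move=> [[A B] /= [nA nB] ABW].
pose V' a := if a == i then V i `&` A^° else if a == k then V k `&` B^° else V a.
have V'V a : V' a `<=` V a.
  by rewrite /V'; case: eqVneq => [->|_]; [|case: eqVneq => [->|_]] => // z [].
exists V'; split=> [a|a b].
  have [Vao V0 VUa] := VU a; split; last exact: subset_trans VUa.
    rewrite /V'; case: eqP => _; first by apply: openI => //; exact: open_interior.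
    by case: eqP => _//; apply: openI => //; exact: open_interior.
  rewrite /V'; case: eqP => _; first by exists x'.
  by case: eqP => _//; exists y'.
rewrite inE => /predU1P[[-> ->] _|abs ab].
  rewrite /V' eqxx eq_sym (negbTE ik) eqxx => -[u v] [/= [_ uA] [_ vB]].
  by apply: ABW; split => /=; exact: interior_subset.
by move=> [u v] [/= /V'V ua /V'V vb]; apply: (VW a b).
Qed.

Fixpoint binary_words n : seq (seq bool) :=
  if n is m.+1 then map (cons false) (binary_words m) ++ map (cons true) (binary_words m)
  else [:: [::]].

(** The most recent digit comes first, so that the parent of a word is its
    tail. *)
Fixpoint rev_prefix (a : nat -> bool) n : seq bool :=
  if n is m.+1 then a m :: rev_prefix a m else [::].

Lemma rev_prefix_words a n : rev_prefix a n \in binary_words n.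
Proof.
elim: n => [|n IH] //=; rewrite mem_cat.
by case: (a n); rewrite map_f// orbT.
Qed.

Lemma eq_rev_prefix a b n : rev_prefix a n = rev_prefix b n <-> agree n a b.
Proof.
split; elim: n => [|n IH] //=.
  move=> [ab /IH abn] k; rewrite ltnS leq_eqVlt => /predU1P[->//|]; exact: abn.
by move=> ab; rewrite ab// IH// => k kn; apply: ab; exact: ltnW.
Qed.

(** A ball is attached to each pair (j, s) of an index and a finite binary word,
    a child lying in its parent and the balls of index j in O j. At stage n the
    radii are made smaller than 1/(n+2), and the products of two different
    balls with index at most n and word length n+1 are put inside W n. The
    point coded by (j, a) is the common point of the balls along a. As W n
    avoids the diagonal, balls of the same stage are disjoint, which makes each
    coding an embedding; two different codes are separated from some stage on,
    so the coded pair belongs to all later W n. *)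
Lemma mycielski (W : nat -> set (X * X)) (O : nat -> set X) :
  (forall n, open (W n) /\ dense (W n)) ->
  (forall n x, ~ W n (x, x)) ->
  (forall j, open (O j) /\ O j !=set0) ->
  exists f : nat -> (nat -> bool) -> X,
    [/\ forall j, cantor_embedding (f j),
        forall j a, O j (f j a) &
        forall j k a b, (j, a) <> (k, b) ->
          exists N, forall n, (N <= n)%N -> W n (f j a, f k b)].
Proof.
move=> Wod Wdiag Oo.
pose I := (nat * seq bool)%type.
(* the finitely many balls that stage n makes pairwise compatible with W n *)
pose L n : seq I := [seq (j, s) | j <- iota 0 n.+1, s <- binary_words n.+1].
have [|next nextP] := @choice (nat * (I -> X * R)) (I -> X * R)
    (fun np q => (forall i, 0 < (np.2 i).2) ->
    [/\ forall i, 0 < (q i).2 <= np.1.+2%:R^-1,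
        forall j s, metric_cball (q (j, s)) `<=` metric_ball (np.2 (j, behead s)) &
        forall i k, i \in L np.1 -> k \in L np.1 -> i != k ->
          metric_ball (q i) `*` metric_ball (q k) `<=` W np.1]).
  move=> [n p] /=.
  have [p0|np0] := pselect (forall i, 0 < (p i).2); last by exists p.
  have [Wo Wd] := Wod n.
  have [|V [VU VW]] := shrink_pairs (U := fun i => metric_ball (p (i.1, behead i.2)))
      [seq (i, k) | i <- L n, k <- L n] Wo Wd.
    move=> i; split; first exact: open_metric_ball.
    by exists (p (i.1, behead i.2)).1; rewrite /metric_ball /= dist_xx.
  have [|q qP] := @choice I (X * R) (fun i q =>
      0 < q.2 <= n.+2%:R^-1 /\ metric_cball q `<=` V i).
    move=> i; have [Vo V0 _] := VU i.
    by apply: cball_in_open => //; rewrite invr_gt0.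
  exists q => _; split.
  - by move=> i; have [] := qP i.
  - move=> j s; have [_ _ /= VUi] := VU (j, s).
    by have [_] := qP (j, s); move/subset_trans; apply.
  - move=> i k iL kL ik [u v] [/= /subset_ball_cball ui /subset_ball_cball vk].
    have [_ qi] := qP i; have [_ qk] := qP k.
    apply: (VW i k) => //; first exact: (allpairs_f pair).
    by split; [exact: qi|exact: qk].
have [|c cP] := @choice nat (X * R) (fun j q =>
    0 < q.2 <= 1 /\ metric_cball q `<=` O j).
  by move=> j; have [? ?] := Oo j; exact: cball_in_open.
pose p := fix p n : I -> X * R := if n is m.+1 then next (m, p m) else fun i => c i.1.
have pr n i : 0 < (p n i).2 <= n.+1%:R^-1.
  elim: n i => [|n IH] i; first by rewrite invr1; have [] := cP i.1.
  have [|+ _ _] := nextP (n, p n); last exact.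
  by move=> k; case/andP: (IH k).
have pS n : _ := nextP (n, p n) (fun i => proj1 (andP (pr n i))).
have [|f fP] := @choice (nat * (nat -> bool)) X (fun ja x => forall n,
    metric_ball (p n (ja.1, rev_prefix ja.2 n)) x).
  move=> [j a]; apply: nested_balls => n; first exact: pr.
  by have [_ + _] := pS n; exact.
have inL n j a : (j <= n)%N -> (j, rev_prefix a n.+1) \in L n.
  move=> jn; apply: (allpairs_f pair); last exact: rev_prefix_words.
  by rewrite mem_iota.
have sep n j k a b : (j <= n)%N -> (k <= n)%N ->
    (j, rev_prefix a n.+1) != (k, rev_prefix b n.+1) ->
    metric_ball (p n.+1 (j, rev_prefix a n.+1)) `*`
    metric_ball (p n.+1 (k, rev_prefix b n.+1)) `<=` W n.
  move=> jn kn ab; have [_ _] := pS n.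
  by apply => //; exact: inL.
exists (fun j a => f (j, a)); split.
- move=> j; split=> [a V|a N].
    move=> /nbhs_metricP[e e0 eV].
    have e20 : 0 < e / 2 by rewrite divr_gt0.
    have [N _ /(_ N (leqnn _))] := near_infty_natSinv_lt (PosNum e20).
    rewrite /= => Ne; exists N => b /eq_rev_prefix ab; apply: eV => /=.
    have := fP (j, a) N; have := fP (j, b) N; rewrite /metric_ball /= ab.
    set q := p N _ => qb qa.
    have := dist_triangle q.1 (f (j, a)) (f (j, b)).
    rewrite (dist_sym (f (j, a)) q.1).
    have /andP[_ /le_lt_trans/(_ Ne)] := pr N (j, rev_prefix b N).
    by rewrite -/q; lra.
  (* index j is separated only from stage j on, hence the maximum *)
  exists (metric_ball (p (maxn j N).+1 (j, rev_prefix a (maxn j N).+1))).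
    apply: open_nbhs_nbhs; split; first exact: open_metric_ball.
    exact: (fP (j, a)).
  move=> b fb.
  suff ab : agree (maxn j N).+1 a b.
    by move=> k kN; apply: ab; rewrite ltnS ltnW// (leq_trans kN)// leq_maxr.
  apply/eq_rev_prefix; apply: contrapT => /eqP ab.
  apply: (Wdiag (maxn j N) (f (j, b))).
  apply: (@sep (maxn j N) j j a b); rewrite ?leq_maxl//.
    by apply: contra ab => /eqP[/= -> ->].
  by split; [exact: fb|exact: (fP (j, b))].
- move=> j a; have [_ cO] := cP j.
  by apply/cO/subset_ball_cball; exact: (fP (j, a) 0).
- move=> j k a b jakb.
  have [m jkm] : exists m, forall n, (m <= n)%N ->
      (j, rev_prefix a n.+1) != (k, rev_prefix b n.+1).
    have [jk|jk] := eqVneq j k; last first.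
      by exists 0 => n _; apply: contra jk => /eqP[->].
    have [m abm] : exists m, a m <> b m.
      apply: contrapT => nab; apply: jakb; rewrite jk; congr pair.
      by apply/funext => m; apply: contrapT => abm; apply: nab; exists m.
    exists m => n mn; apply/negP => /eqP/pair_equal_spec[_ /eq_rev_prefix ab].
    by apply: abm; apply: ab; rewrite ltnS.
  exists (maxn m (maxn j k)) => n; rewrite !geq_max => /and3P[mn jn kn].
  apply: (sep n j k a b) => //; first exact: jkm.
  by split; [exact: (fP (j, a))|exact: (fP (k, b))].
Qed.

End CompatibleMetric.
(** * Orbits of an endomorphism relative to the identity *)

Section Endomorphism.
Context {R : realType} {G : topologicalGroupType} {d : G -> G -> R}.
Hypothesis d_compat : compatible_metric d.
Hypothesis d_left : left_invariant d.
Variable T : {multiplicative G -> G}.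
Hypothesis T_cont : continuous T.

Local Notation dist1 x n := (d (iter n T x) 1%g).

Lemma iter_endoM n x y : iter n T (x * y)%g = (iter n T x * iter n T y)%g.
Proof. by elim: n => //= n ->; rewrite gmulfM. Qed.

Lemma iter_endo1 n : iter n T 1%g = 1%g.
Proof.
by apply: (mulgI (iter n T 1%g)); rewrite -iter_endoM !mulg1.
Qed.

(** The identity that reduces pairs of points to single orbits. *)
Lemma dist_iter n x y : d (iter n T x) (iter n T y) = dist1 (y^-1 * x)%g n.
Proof.
by rewrite -{1}(mulVKg y x) iter_endoM -{2}(mulg1 (iter n T y)) d_left.
Qed.

Lemma liminf_distE x y :
  liminf_dist d T x y = limn_einf (fun n => (dist1 (y^-1 * x)%g n)%:E).
Proof. by congr limn_einf; apply/funext => n; rewrite dist_iter. Qed.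

Lemma limsup_distE x y :
  limsup_dist d T x y = limn_esup (fun n => (dist1 (y^-1 * x)%g n)%:E).
Proof. by congr limn_esup; apply/funext => n; rewrite dist_iter. Qed.

Lemma proximal_cell1E x :
  proximal_cell d T 1%g x <-> limn_einf (fun n => (dist1 x n)%:E) = 0%E.
Proof.
rewrite /proximal_cell /proximal_relation /= /liminf_dist.
by under eq_fun do rewrite (dist_sym d_compat) iter_endo1.
Qed.

Lemma orbit_ge0 x n : 0 <= dist1 x n.
Proof. exact: (dist_ge0 d_compat). Qed.

Lemma proximal_cell1P x : proximal_cell d T 1%g x <->
  forall e : R, 0 < e -> forall N, exists2 n, (N <= n)%N & dist1 x n < e.
Proof.
by rewrite proximal_cell1E; apply: limn_einf_eq0P; exact: orbit_ge0.
Qed.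

Lemma continuous_iter n : continuous (iter n T).
Proof.
elim: n => [|n IH] x; first exact: cvg_id.
by apply: (@continuous_comp _ _ _ (iter n T) T); [exact: IH|exact: T_cont].
Qed.

Lemma open_orbit_lt n c : open [set x | dist1 x n < c].
Proof.
have /continuousP := @continuous_iter n.
move=> /(_ (metric_ball d (1%g, c)) (open_metric_ball d_compat _)).
by congr open; apply/funext => x; rewrite /metric_ball /= (dist_sym d_compat).
Qed.

Lemma open_orbit_gt n c : open [set x | c < dist1 x n].
Proof.
have /continuousP := @continuous_iter n.
move=> /(_ [set x | c < d x 1%g]); apply.
rewrite openE => x /= cx; apply/(nbhs_metricP d_compat).
exists (d x 1%g - c) => [|y /= xy]; first by rewrite subr_gt0.
by have := dist_triangle d_compat y x 1%g; lra.
Qed.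

Lemma nbhs_translate (x : G) (O : set G) : nbhs x O ->
  nbhs (1%g : G) [set u | O (x * u)%g].
Proof.
move=> /(nbhs_metricP d_compat)[e e0 eO]; apply/(nbhs_metricP d_compat).
exists e => // u /= u1; apply: eO => /=.
by rewrite -{1}(mulg1 x) d_left.
Qed.

Lemma continuous_ldiv : continuous (fun p : G * G => (p.2^-1 * p.1)%g).
Proof.
move=> p; apply: (@continuous_comp _ _ _ (fun p : G * G => (p.2^-1%g, p.1))
    (fun q : G * G => (q.1 * q.2)%g)); last exact: mulg_continuous.
apply: cvg_pair; last exact: cvg_fst.
apply: (@continuous_comp _ _ _ (fun p : G * G => p.2) (fun x : G => x^-1%g)).
  exact: cvg_snd.
exact: invg_continuous.
Qed.

(** * Generic orbits *)

Definition sensitive_at1 (delta : R) := forall U : set G, nbhs (1%g : G) U ->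
  exists2 u, U u & exists n, delta < dist1 u n.

Definition visits_near (n : nat) :=
  [set x | exists2 m, (n <= m)%N & dist1 x m < n.+1%:R^-1].

Definition visits_far (delta : R) (n : nat) :=
  [set x | exists2 m, (n <= m)%N & delta < dist1 x m].

Lemma open_visits_near n : open (visits_near n).
Proof. by apply: bigcup_open => m _; exact: open_orbit_lt. Qed.

Lemma open_visits_far delta n : open (visits_far delta n).
Proof. by apply: bigcup_open => m _; exact: open_orbit_gt. Qed.

Lemma dense_visits_near n :
  dense (proximal_cell d T 1%g) -> dense (visits_near n).
Proof.
move=> cell O O0 Oo; have [x [Ox /proximal_cell1P xP]] := cell O O0 Oo.
by exists x; split => //; apply: xP; rewrite invr_gt0.
Qed.

(** Take u near e with a late escape, d (T^m u) e > delta. Since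
    d (T^m (x u)) (T^m x) = d (T^m u) e, one of the points x and x u is at time
    m further than delta/2 from e. *)
Lemma dense_visits_far delta n : 0 < delta -> sensitive_at1 delta ->
  dense (visits_far (delta / 2) n).
Proof.
move=> delta0 sens O [x Ox] Oo.
(* starting close enough to e delays the escape beyond time k *)
have early k : nbhs (1%g : G) [set u | forall m, (m < k)%N -> dist1 u m < delta].
  elim: k => [|k IH]; first exact: filterS filterT.
  have nk : nbhs (1%g : G) [set u | dist1 u k < delta].
    apply: open_nbhs_nbhs; split; first exact: open_orbit_lt.
    by rewrite /= iter_endo1 (dist_xx d_compat).
  apply: filterS2 IH nk => u uk ukk m; rewrite ltnS leq_eqVlt.
  by move=> /predU1P[->|/uk].
have nxO := nbhs_translate (open_nbhs_nbhs (conj Oo Ox)).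
have [u [/= Oxu uearly] [m um]] := sens _ (filterI nxO (early n)).
have nm : (n <= m)%N.
  by rewrite leqNgt; apply/negP => /uearly; rewrite ltNge ltW.
have : dist1 u m <= dist1 (x * u)%g m + dist1 x m.
  rewrite -[u in dist1 u m](mulKg x) -dist_iter -(dist_sym d_compat 1%g (iter m T x)).
  exact: (dist_triangle d_compat).
have [xm _|xm] := ltP (delta / 2) (dist1 x m); first by exists x; split=> //; exists m.
by exists (x * u)%g; split=> //; exists m => //; lra.
Qed.

(** Otherwise orbits starting in some neighborhood U of e stay within c/2 of e,
    where c bounds infinitely many distances of the orbit of x from below.
    A point y of the proximal cell with x^-1 y in U enters U at some time,
    after which both T^n y and then T^n x stay too close to e. *)
Lemma sensitive_at1_of_proximal (x : G) : dense (proximal_cell d T 1%g) ->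
  (0 < limn_esup (fun n => (dist1 x n)%:E))%E ->
  exists2 delta, 0 < delta & sensitive_at1 delta.
Proof.
move=> cell /limn_esup_gt0P[c c0 xc]; exists (c / 2); first by rewrite divr_gt0.
apply: contrapT => nsens.
have [U nU Uc] : exists2 U : set G, nbhs (1%g : G) U &
    forall u, U u -> forall n, dist1 u n <= c / 2.
  apply: contrapT => nU; apply: nsens => U nbU; apply: contrapT => nu.
  apply: nU; exists U => // u Uu n; rewrite leNgt; apply/negP => un.
  by apply: nu; exists u => //; exists n.
pose O := [set y | U (x^-1 * y)%g].
have nO : nbhs x O.
  move: nU => /(nbhs_metricP d_compat)[e e0 eU]; apply/(nbhs_metricP d_compat).
  by exists e => // y /= xy; apply: eU => /=; rewrite -(d_left _ _ x) mulg1 mulVKg.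
have [y [Oy /proximal_cell1P yP]] := cell O^° (ex_intro _ x nO) (@open_interior _ O).
have [r r0 rU] := (nbhs_metricP d_compat _ _).1 nU.
have [k _ yk] := yP r r0 0.
have [n kn xn] := xc k.
have yn : dist1 y n <= c / 2.
  rewrite -(subnK kn) iterD; apply: Uc; apply: rU => /=.
  by rewrite (dist_sym d_compat).
have xy : dist1 (x^-1 * y)%g n <= c / 2 by apply: Uc; exact: (interior_subset Oy).
move: xy; rewrite -dist_iter (dist_sym d_compat) => xy.
by have := dist_triangle d_compat (iter n T y) (iter n T x) 1%g; lra.
Qed.

(** The dense open sets used by the two category arguments. Only membership in
    almost all of them is required in the last clause, because the points of
    Mycielski's Cantor sets satisfy no more than that. *)
Lemma generic_sets (x : G) : dense (proximal_cell d T 1%g) ->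
  (0 < limn_esup (fun n => (dist1 x n)%:E))%E ->
  exists2 delta : R, 0 < delta & exists V : nat -> set G,
  [/\ forall n, open (V n) /\ dense (V n), forall n, ~ V n 1%g &
      forall y, (exists N, forall n, (N <= n)%N -> V n y) ->
        limn_einf (fun n => (dist1 y n)%:E) = 0%E /\
        (delta%:E <= limn_esup (fun n => (dist1 y n)%:E))%E].
Proof.
move=> cell x0; have [delta delta0 sens] := sensitive_at1_of_proximal cell x0.
have d20 : 0 < delta / 2 by rewrite divr_gt0.
exists (delta / 2) => //; exists (fun n => visits_near n `&` visits_far (delta / 2) n).
split=> [n|n [_ [m _]]|y [N yN]].
- split; first by apply: openI; [exact: open_visits_near|exact: open_visits_far].
  apply: denseI; [exact: open_visits_near|exact: dense_visits_near|].
  exact: dense_visits_far.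
- by rewrite iter_endo1 (dist_xx d_compat) ltNge ltW.
split.
  apply/(limn_einf_eq0P (orbit_ge0 y)) => e e0 M.
  have [K _ /(_ K (leqnn _)) /= Ke] := near_infty_natSinv_lt (PosNum e0).
  have [|[m Km ym] _] := yN (maxn M (maxn K N)); first by rewrite !leq_max leqnn !orbT.
  exists m; first by apply: leq_trans Km; exact: leq_maxl.
  apply: lt_le_trans ym _; apply: le_trans (ltW Ke).
  by rewrite lef_pV2 ?posrE// ler_nat ltnS !leq_max leqnn orbT.
apply: le_limn_esup => M.
have [|_ [m Mm ym]] := yN (maxn M N); first exact: leq_maxr.
by exists m => //; apply: leq_trans Mm; exact: leq_maxl.
Qed.

(** For fixed y the map x |-> y^-1 x is a homeomorphism, so moving the first
    coordinate alone reaches V. *)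
Lemma dense_preimage_ldiv (V : set G) : dense V ->
  dense [set p : G * G | V (p.2^-1 * p.1)%g].
Proof.
move=> Vd O [[x y] Oxy] Oo.
have : nbhs (x, y) O by exact: open_nbhs_nbhs.
move=> [[A B] /= [nA nB] ABO].
have nyA : nbhs (y^-1 * x)%g [set v | A (y * v)%g].
  move: nA => /(nbhs_metricP d_compat)[e e0 eA]; apply/(nbhs_metricP d_compat).
  by exists e => // v /= yv; apply: eA => /=; rewrite -(d_left _ _ y^-1%g) mulKg.
have [v [/interior_subset Av Vv]] :=
  Vd _^° (ex_intro _ (y^-1 * x)%g nyA) (@open_interior _ _).
exists ((y * v)%g, y); split; last by rewrite /= mulKg.
by apply: ABO; split => //=; exact: nbhs_singleton.
Qed.

Lemma sensitive_at1_of_sensitive : sensitive d T ->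
  exists2 delta, 0 < delta & sensitive_at1 delta.
Proof.
move=> [delta delta0 sens]; exists delta => // U /(nbhs_metricP d_compat)[e e0 eU].
have [u [u1 [n _ un]]] := sens 1%g e e0.
exists u; first exact: eU.
by exists n; rewrite -(iter_endo1 n) (dist_sym d_compat).
Qed.

(** * The implications *)

Definition cell_and_escape := dense (proximal_cell d T 1%g) /\
  exists x : G, (0 < limn_esup (fun n => (dist1 x n)%:E))%E.

Lemma escape_of_dense_semi_irregular :
  dense [set x | semi_irregular d T x] -> cell_and_escape.
Proof.
move=> semi; split=> [ O O0 Oo|].
  have [x [Ox [x0 _]]] := semi O O0 Oo.
  by exists x; split => //; apply/proximal_cell1E.
by have [x [_ [_ x0]]] := semi setT (ex_intro _ 1%g I) openT; exists x.
Qed.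

Lemma residual_dense (S : set G) : residual S -> dense S.
Proof.
move=> [D [_ Dd DS]] O O0 Oo; have [x [Ox Dx]] := Dd O O0 Oo.
by exists x; split=> //; exact: DS.
Qed.

Lemma residual_semi_irregular : completely_metrizable R G -> cell_and_escape ->
  residual [set x | semi_irregular d T x].
Proof.
move=> [rho rho_compat rho_compl] [cell [x x0]].
have [delta delta0 [V [Vod _ VP]]] := generic_sets cell x0.
exists (\bigcap_n V n); split.
- by exists V => // n; have [] := Vod n.
- exact: baire_metric rho_compat rho_compl _ Vod.
- move=> y yV; have [|y0 ydelta] := VP y; first by exists 0 => n _; exact: yV.
  by split=> //; apply: lt_le_trans ydelta; rewrite lte_fin.
Qed.

Definition scrambled_cantor_sets := exists2 delta : R, 0 < delta &
  forall O : nat -> set G, (forall j, open (O j) /\ O j !=set0) ->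
    exists K : nat -> set G,
      (forall j, is_cantor_set R (K j) /\ K j `<=` O j) /\
      li_yorke_scrambled d T delta (\bigcup_j K j).

Lemma scrambled_cantor_sets_of_escape : completely_metrizable R G ->
  cell_and_escape -> scrambled_cantor_sets.
Proof.
move=> [rho rho_compat rho_compl] [cell [x x0]].
have [delta delta0 [V [Vod V1 VP]]] := generic_sets cell x0.
exists delta => // O Oo.
have [| |f [femb fO fV]] := mycielski rho_compat rho_compl
    (W := fun n => [set p | V n (p.2^-1 * p.1)%g]) _ _ Oo.
- move=> n; have [Vo Vd] := Vod n; split; last exact: dense_preimage_ldiv.
  by have /continuousP := continuous_ldiv; apply.
- by move=> n y; rewrite /= mulVg.
exists (fun j => range (f j)); split=> [j|].
  by split; [exact: cantor_embedding_range|move=> _ [a _ <-]].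
move=> _ _ [j _ [a _ <-]] [k _ [b _ <-]] ab.
rewrite /li_yorke_pair liminf_distE limsup_distE; apply/VP/fV.
by move=> [jk abk]; apply: ab; rewrite jk abk.
Qed.

(** The two points come from the constant digit sequences, i.e. from 0 and 1 in
    the ternary set. *)
Lemma cantor_set_two_points (X : topologicalType) (K : set X) :
  is_cantor_set R K -> exists x y, [/\ K x, K y & x <> y].
Proof.
rewrite /is_cantor_set -range_ternary => -[f [g [_ _ fK _]]].
pose t b : R := ternary (fun=> b).
have tr b : range (@ternary R) (t b) by exists (fun=> b).
exists (f (t false)), (f (t true)).
have [Kf gf] := fK _ (tr false); have [Kt gt] := fK _ (tr true).
split=> // ff; have : t false = t true by rewrite -gf ff gt.
by move=> /(cantor_embedding_inj ternary_embedding)/(congr1 (@^~ 0%N)).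
Qed.

(** Applied to the two sides of an open box, the scrambled sets give a proximal
    pair in the box, possibly on the diagonal. Applied to a ball around x, they
    give two points a and b of the ball whose orbits are more than delta/2 apart
    at some positive time, and then one of the two is more than delta/4 away
    from the orbit of x. *)
Lemma proximal_sensitive_of_scrambled : scrambled_cantor_sets ->
  dense (proximal_relation d T) /\ sensitive d T.
Proof.
move=> [delta delta0 scr]; split.
  move=> O [[x y] Oxy] Oo.
  have : nbhs (x, y) O by exact: open_nbhs_nbhs.
  move=> [[A B] /= [nA nB] ABO].
  have [|K [KP Kscr]] := scr (fun j => if j is 0 then A^° else B^°).
    by case=> [|j]; (split; first exact: open_interior); [exists x|exists y].
  have [a [_ [Ka _ _]]] := cantor_set_two_points (KP 0%N).1.
  have [b [_ [Kb _ _]]] := cantor_set_two_points (KP 1%N).1.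
  exists (a, b); split.
    apply: ABO; split => /=; apply: interior_subset.
      exact: (KP 0%N).2.
    exact: (KP 1%N).2.
  rewrite /proximal_relation /=; have [->|ab] := pselect (a = b).
    rewrite liminf_distE mulVg; apply/(limn_einf_eq0P (orbit_ge0 1%g)) => e e0 N.
    by exists N => //; rewrite iter_endo1 (dist_xx d_compat).
  by have [] := Kscr a b (ex_intro2 _ _ 0%N I Ka) (ex_intro2 _ _ 1%N I Kb) ab.
exists (delta / 4) => [|x e e0]; first by rewrite divr_gt0.
have [|K [KP Kscr]] := scr (fun=> metric_ball d (x, e)).
  move=> _; split; first exact: open_metric_ball.
  by exists x; exact: metric_ball_center.
have [KC Ke] := KP 0%N.
have [a [b [Ka Kb ab]]] := cantor_set_two_points KC.
have [_ abdelta] := Kscr a b (ex_intro2 _ _ 0%N I Ka) (ex_intro2 _ _ 0%N I Kb) ab.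
have [|n n0 abn] := limn_esup_gt (c := delta / 2) (lt_le_trans _ abdelta) 1.
  by rewrite lte_fin; lra.
have := dist_triangle d_compat (iter n T x) (iter n T a) (iter n T b).
rewrite (dist_sym d_compat (iter n T a) (iter n T x)) => tri.
have [xan|xan] := ltP (delta / 4) (d (iter n T x) (iter n T a)).
  by exists a; split; [exact: Ke|exists n].
by exists b; split; [exact: Ke|exists n => //; lra].
Qed.

(** Density of the proximal relation passes to the cell through
    (x, y) |-> y^-1 x; a generic point escapes, by sensitivity at e and the
    Baire property. *)
Lemma escape_of_proximal_sensitive : completely_metrizable R G ->
  dense (proximal_relation d T) /\ sensitive d T -> cell_and_escape.
Proof.
move=> [rho rho_compat rho_compl] [prox /sensitive_at1_of_sensitive[delta delta0 sens]].
split.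
  move=> O [x Ox] Oo.
  have [||[y z] [/= Oyz yz]] := prox [set p : G * G | O (p.2^-1 * p.1)%g].
  - by exists (x, 1%g); rewrite /= invg1 mul1g.
  - by have /continuousP := continuous_ldiv; apply.
  - exists (z^-1 * y)%g; split=> //.
    by apply/proximal_cell1E; rewrite -liminf_distE.
have [|x [_ xV]] := baire_metric rho_compat rho_compl
    (V := visits_far (delta / 2)) _ (ex_intro _ 1%g I) openT.
  by move=> n; split; [exact: open_visits_far|exact: dense_visits_far].
exists x; apply/limn_esup_gt0P; exists (delta / 2); first by rewrite divr_gt0.
by move=> N; exact: xV.
Qed.

End Endomorphism.

Theorem theorem3p13 (R : realType) (G : topologicalGroupType)
  (hG : completely_metrizable R G)
  (d : G -> G -> R) (hd : compatible_metric d) (hdl : left_invariant d)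
  (T : {multiplicative G -> G}) (hT : continuous T) :
  [<-> (* 1 *) dense [set x | semi_irregular d T x] ;
       (* 2 *) residual [set x | semi_irregular d T x] ;
       (* 3 *) exists2 delta : R, 0 < delta &
         forall O : nat -> set G, (forall j, open (O j) /\ O j !=set0) ->
           exists K : nat -> set G,
             (forall j, is_cantor_set R (K j) /\ K j `<=` O j) /\
             li_yorke_scrambled d T delta (\bigcup_j K j) ;
       (* 4 *) dense (proximal_relation d T) /\ sensitive d T ;
       (* 5 *) dense (proximal_cell d T 1%g) /\
         exists x : G,
           (0 < limn_esup (fun n => (d (iter n T x) 1%g)%:E))%E].
Proof.
tfae.
- by move=> /(escape_of_dense_semi_irregular hd)/(residual_semi_irregular hd hdl hT hG).
- move=> /residual_dense/(escape_of_dense_semi_irregular hd).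
  exact: scrambled_cantor_sets_of_escape.
- exact: proximal_sensitive_of_scrambled.
- exact: escape_of_proximal_sensitive.
- by move=> /(residual_semi_irregular hd hdl hT hG)/residual_dense.
Qed.
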